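(* (Nonlinear ISS small-gain theorem in semi-maximum formulation.) Let $I$ be an arbitrary nonempty index set, let $(X_i,\|\cdot\|_{X_i})$, $i\in I$, be normed spaces and let $\Sigma_i=(X_i,\mathrm{PC}_b(\mathbb{R}_+,X_{\neq i})\times\mathcal{U},\bar\phi_i)$, $i\in I$, be forward complete control systems. Assume that the interconnection $\Sigma=(X,\mathcal{U},\phi)$ of the systems $\Sigma_i$ is well-defined. Furthermore, assume: (i) Each system $\Sigma_i$ is ISS in semi-maximum formulation, with $\beta_i\in\mathcal{KL}$ and nonlinear gains $\gamma_{ij},\gamma_i\in\mathcal{K}\cup\{0\}$ ($j\in I$). (ii) There are $\beta_{\max}\in\mathcal{KL}$ and $\gamma_{\max}\in\mathcal{K}$ such that $\beta_i\le\beta_{\max}$ and $\gamma_i\le\gamma_{\max}$ pointwise for all $i\in I$. (iii) It holds that $\sup_{i,j\in I}\gamma_{ij}(r)<\infty$ for every $r>0$, and, with $\Gamma_\otimes:\ell_\infty(I)^+\to\ell_\infty(I)^+$, $\Gamma_\otimes(s):=(\sup_{j\in I}\gamma_{ij}(s_j))_{i\in I}$, the discrete-time system $w(k+1)\le\Gamma_\otimes(w(k))+v(k)$, with $w(\cdot),v(\cdot)$ taking values in $\ell_\infty(I)^+$, has the MLIM property. Then $\Sigma$ is ISS.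
   Context: **Comparison functions.** $\mathcal{K}$: continuous strictly increasing $\gamma:\mathbb{R}_+\to\mathbb{R}_+$ with $\gamma(0)=0$. $\mathcal{K}_\infty$: unbounded functions in $\mathcal{K}$. $\mathcal{L}$: continuous strictly decreasing $\gamma:\mathbb{R}_+\to\mathbb{R}_+$ with $\gamma(t)\to0$ as $t\to\infty$. $\mathcal{KL}$: continuous $\beta:\mathbb{R}_+^2\to\mathbb{R}_+$ with $\beta(\cdot,t)\in\mathcal{K}$ for all $t\ge0$ and $\beta(r,\cdot)\in\mathcal{L}$ for all $r>0$. In $\mathcal{K}\cup\{0\}$, $0$ is the zero function. **Sequence spaces.** $\ell_\infty(I)$ is the Banach space of bounded functions $x:I\to\mathbb{R}$ with the sup-norm; $\ell_\infty(I)^+$ is the cone of its componentwise nonnegative elements; $\le$ is the componentwise order. For $w:J\to W$ bounded, $J\subset\mathbb{R}_+$ nonempty, $W$ normed, $\|w\|_J:=\sup_{s\in J}\|w(s)\|_W$. **MLIM property.** Let $(X,X^+)$ be an ordered Banach space and $A:X^+\to X^+$ an operator. The system $x(k+1)\le A(x(k))+u(k)$, $k\in\mathbb{Z}_+$, has the monotone limit (MLIM) property if there is $\xi\in\mathcal{K}_\infty$ such that for every $\varepsilon>0$, every constant input $u(\cdot)\equiv w\in X^+$ and every decreasing solution $x:\mathbb{Z}_+\to X^+$ (i.e. a map satisfying the inequality for all $k$, with $x(k+1)\le x(k)$ for all $k$) there is $N\in\mathbb{Z}_+$ (depending on $\varepsilon,u,x(\cdot)$) with $\|x(N)\|_X\le\varepsilon+\xi(\|w\|_X)$.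 Here it is used with $X=\ell_\infty(I)$, $X^+=\ell_\infty(I)^+$. **Control systems.** A control system is a triple $\Sigma=(X,\mathcal{U},\phi)$ with: a normed space $(X,\|\cdot\|_X)$ (state space); a vector space $U$ of input values and a normed space of inputs $(\mathcal{U},\|\cdot\|_{\mathcal{U}})$, $\mathcal{U}$ a linear subspace of $U^{\mathbb{R}_+}$ (all maps $\mathbb{R}_+\to U$), satisfying shift invariance (for all $u\in\mathcal{U}$, $\tau\ge0$: $u(\cdot+\tau)\in\mathcal{U}$ and $\|u\|_{\mathcal{U}}\ge\|u(\cdot+\tau)\|_{\mathcal{U}}$) and concatenation (for all $u_1,u_2\in\mathcal{U}$, $t>0$, the function equal to $u_1(\tau)$ for $\tau\in[0,t]$ and $u_2(\tau-t)$ for $\tau>t$ is in $\mathcal{U}$); a transition map $\phi:D_\phi\to X$, $D_\phi\subseteq\mathbb{R}_+\times X\times\mathcal{U}$, such that for all $(x,u)$ one has $D_\phi\cap(\mathbb{R}_+\times\{(x,u)\})=[0,t_m)\times\{(x,u)\}$ for some $t_m=t_m(x,u)\in(0,\infty]$. The following axioms are required: $\phi(0,x,u)=x$; causality (if $(t,x,u)\in D_\phi$ and $\tilde u\in\mathcal{U}$ agrees with $u$ on $[0,t]$, then $[0,t]\times\{(x,\tilde u)\}\subset D_\phi$ and $\phi(t,x,u)=\phi(t,x,\tilde u)$); continuity of $t\mapsto\phi(t,x,u)$ on $[0,t_m(x,u))$; cocycle property (if $[0,t+h]\times\{(x,u)\}\subset D_\phi$, $t,h\ge 0$, then $\phi(h,\phi(t,x,u),u(t+\cdot))=\phi(t+h,x,u)$).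 $\Sigma$ is forward complete if $D_\phi=\mathbb{R}_+\times X\times\mathcal{U}$. $\Sigma$ has the boundedness-implies-continuation (BIC) property if for each $(x,u)$ with $t_m(x,u)<\infty$ and each $M>0$ there is $t\in[0,t_m)$ with $\|\phi(t,x,u)\|_X>M$. **ISS.** $\Sigma$ is input-to-state stable (ISS) if there are $\beta\in\mathcal{KL}$, $\gamma\in\mathcal{K}\cup\{0\}$ with $\|\phi(t,x,u)\|_X\le\beta(\|x\|_X,t)+\gamma(\|u\|_{\mathcal{U}})$ for all $(t,x,u)\in D_\phi$. **Interconnections.** Given normed spaces $X_i$, $i\in I$, put $X:=\{(x_i)_{i\in I}\in\prod_i X_i:\sup_i\|x_i\|_{X_i}<\infty\}$ with $\|x\|_X:=\sup_i\|x_i\|_{X_i}$, and let $X_{\neq i}$ be the same construction for the index set $I\setminus\{i\}$. $\mathrm{PC}_b(\mathbb{R}_+,X_{\neq i})$ is the space of globally bounded piecewise continuous functions $w:\mathbb{R}_+\to X_{\neq i}$ with sup-norm $\|w\|_\infty$. $\mathcal{U}$ is a fixed normed space of inputs (satisfying shift invariance and concatenation), common to all subsystems, and $\mathrm{PC}_b(\mathbb{R}_+,X_{\neq i})\times\mathcal{U}$ has norm $\max\{\|w\|_\infty,\|u\|_{\mathcal{U}}\}$. Given control systems $\Sigma_i=(X_i,\mathrm{PC}_b(\mathbb{R}_+,X_{\neq i})\times\mathcal{U},\bar\phi_i)$, consider maps $\phi:D_\phi\to X$, $D_\phi\subset\mathbb{R}_+\times X\times\mathcal{U}$, such that (1) for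 each $(x,u)\in X\times\mathcal{U}$ there is $\varepsilon>0$ with $[0,\varepsilon]\times\{(x,u)\}\subset D_\phi$; (2) the components satisfy $\phi_i(t,x,u)=\bar\phi_i(t,x_i,(\phi_{\neq i},u))$ for all $(t,x,u)\in D_\phi$, $i\in I$, where $\phi_{\neq i}(\cdot)=(\phi_j(\cdot,x,u))_{j\in I\setminus\{i\}}$ (by causality only the values of $\phi_{\neq i}$ on $[0,t]$ matter, so it can be regarded as globally bounded); and $\phi$ is maximal, i.e. no proper extension of $\phi$ satisfies these properties. If the map $\phi$ with these properties is unique and $\Sigma=(X,\mathcal{U},\phi)$ is a control system satisfying the BIC property, then $\Sigma$ is called the (well-defined) interconnection of the $\Sigma_i$. **ISS of $\Sigma_i$ in semi-maximum formulation.** $\Sigma_i$ is forward complete and there are $\beta_i\in\mathcal{KL}$ and $\gamma_{ij},\gamma_i\in\mathcal{K}\cup\{0\}$ ($j\in I$) such that for all $x_i\in X_i$, $w_{\neq i}=(w_j)_{j\in I\setminus\{i\}}\in\mathrm{PC}_b(\mathbb{R}_+,X_{\neq i})$, $u\in\mathcal{U}$, $t\ge0$: $\|\bar\phi_i(t,x_i,(w_{\neq i},u))\|_{X_i}\le\beta_i(\|x_i\|_{X_i},t)+\sup_{j\in I}\gamma_{ij}(\|w_j\|_{[0,t]})+\gamma_i(\|u\|_{\mathcal{U}})$, where $\sup_{j\in I}\gamma_{ij}(r)<\infty$ for every $r\ge0$ and $\gamma_{ii}=0$ (so the term $j=i$ is $0$). *)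

(* Defs.v *)
From HB Require Import structures.
From mathcomp Require Import all_boot all_order all_algebra.
From mathcomp Require Import all_classical all_reals all_analysis.

Set Implicit Arguments.
Unset Strict Implicit.
Unset Printing Implicit Defensive.

Import Order.TTheory GRing.Theory Num.Theory.
Import numFieldNormedType.Exports.

Local Open Scope classical_set_scope.
Local Open Scope ring_scope.

Section BoundedFamilies.
Context {R : realType} {T : Type} (X : T -> normedModType R).

Record bfam := Bfam {
  bfun :> forall i, X i;
  bfunP : exists M : R, forall i, `|bfun i| <= M }.

Lemma bfam_ext (x y : bfam) : (forall i, x i = y i) -> x = y.
Proof.
case: x y => [x xP] [y yP] /= xy.
have {}xy : x = y by apply: functional_extensionality_dep.
by subst y; congr Bfam; exact: Prop_irrelevance.
Qed.

HB.instance Definition _ := gen_eqMixin bfam.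
HB.instance Definition _ := gen_choiceMixin bfam.

Fact bfam0_subproof : exists M : R, forall i, `|0 : X i| <= M.
Proof. by exists 0 => i; rewrite normr0. Qed.

Fact bfamN_subproof (x : bfam) : exists M : R, forall i, `|- x i| <= M.
Proof. by have [M xM] := bfunP x; exists M => i; rewrite normrN. Qed.

Fact bfamD_subproof (x y : bfam) : exists M : R, forall i, `|x i + y i| <= M.
Proof.
have [M xM] := bfunP x; have [N yN] := bfunP y; exists (M + N) => i.
have xMi := xM i; have yNi := yN i.
exact: (le_trans (ler_normD _ _) (lerD xMi yNi)).
Qed.

Fact bfamZ_subproof (a : R) (x : bfam) : exists M : R, forall i, `|a *: x i| <= M.
Proof.
have [M xM] := bfunP x; exists (`|a| * M) => i; have xMi := xM i.
by rewrite normrZ; exact: ler_wpM2l xMi.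
Qed.

Let zerob := Bfam bfam0_subproof.
Let oppb x := Bfam (bfamN_subproof x).
Let addb x y := Bfam (bfamD_subproof x y).
Let scaleb a x := Bfam (bfamZ_subproof a x).

Fact bfam_addA : associative addb.
Proof. by move=> x y z; apply: bfam_ext => i /=; rewrite addrA. Qed.
Fact bfam_addC : commutative addb.
Proof. by move=> x y; apply: bfam_ext => i /=; rewrite addrC. Qed.
Fact bfam_add0 : left_id zerob addb.
Proof. by move=> x; apply: bfam_ext => i /=; rewrite add0r. Qed.
Fact bfam_addN : left_inverse zerob oppb addb.
Proof. by move=> x; apply: bfam_ext => i /=; rewrite addNr. Qed.

HB.instance Definition _ :=
  GRing.isZmodule.Build bfam bfam_addA bfam_addC bfam_add0 bfam_addN.

Fact bfam_scaleA a b x : scaleb a (scaleb b x) = scaleb (a * b) x.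
Proof. by apply: bfam_ext => i /=; rewrite scalerA. Qed.
Fact bfam_scale1 : left_id 1 scaleb.
Proof. by move=> x; apply: bfam_ext => i /=; rewrite scale1r. Qed.
Fact bfam_scaleDr : right_distributive scaleb +%R.
Proof. by move=> a x y; apply: bfam_ext => i /=; rewrite scalerDr. Qed.
Fact bfam_scaleDl x : {morph scaleb^~ x : a b / a + b}.
Proof. by move=> a b; apply: bfam_ext => i /=; rewrite scalerDl. Qed.

HB.instance Definition _ := GRing.Zmodule_isLmodule.Build R bfam
  bfam_scaleA bfam_scale1 bfam_scaleDr bfam_scaleDl.

Lemma bfamDE (x y : bfam) i : (x + y) i = x i + y i. Proof. by []. Qed.
Lemma bfamNE (x : bfam) i : (- x) i = - x i. Proof. by []. Qed.
Lemma bfamBE (x y : bfam) i : (x - y) i = x i - y i. Proof. by []. Qed.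
Lemma bfamZE a (x : bfam) i : (a *: x) i = a *: x i. Proof. by []. Qed.
Lemma bfam0E i : (0 : bfam) i = 0. Proof. by []. Qed.

(* When [T] is empty, [sup set0 = 0] makes this the norm of the zero space. *)
Definition bfam_norm (x : bfam) : R := sup (range (fun i => `|x i|)).

Fact bfam_norm_ub (x : bfam) : has_ubound (range (fun i => `|x i|)).
Proof. by have [M xM] := bfunP x; exists M => _ [i _ <-]. Qed.

Fact le_bfam_norm (x : bfam) i : `|x i| <= bfam_norm x.
Proof. by apply: ub_le_sup; [exact: bfam_norm_ub|exists i]. Qed.

Fact bfam_norm_le (x : bfam) M :
  0 <= M -> (forall i, `|x i| <= M) -> bfam_norm x <= M.
Proof.
move=> M0 xM; rewrite /bfam_norm.
have [->|/set0P ne] := eqVneq (range (fun i => `|x i|)) set0.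
  by rewrite sup0.
by apply: ge_sup => // _ [i _ <-].
Qed.

Fact bfam_norm_ge0 (x : bfam) : 0 <= bfam_norm x.
Proof.
rewrite /bfam_norm.
have [->|/set0P[_ [i _ _]]] := eqVneq (range (fun i => `|x i|)) set0.
  by rewrite sup0.
exact: le_trans (normr_ge0 (x i)) (le_bfam_norm x i).
Qed.

Fact bfam_normD x y : bfam_norm (x + y) <= bfam_norm x + bfam_norm y.
Proof.
apply: bfam_norm_le; first by rewrite addr_ge0 ?bfam_norm_ge0.
by move=> i; rewrite bfamDE (le_trans (ler_normD _ _))// lerD ?le_bfam_norm.
Qed.

Fact bfam_norm0_eq0 x : bfam_norm x = 0 -> x = 0.
Proof.
move=> x0; apply: bfam_ext => i; apply/eqP.
by rewrite bfam0E -normr_eq0 eq_le normr_ge0 andbT -x0 le_bfam_norm.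
Qed.

Fact bfam_normZ_le a x : bfam_norm (a *: x) <= `|a| * bfam_norm x.
Proof.
apply: bfam_norm_le; first by rewrite mulr_ge0 ?bfam_norm_ge0.
by move=> i; rewrite bfamZE normrZ ler_wpM2l ?le_bfam_norm.
Qed.

Fact bfam_normZ a x : bfam_norm (a *: x) = `|a| * bfam_norm x.
Proof.
apply/eqP; rewrite eq_le bfam_normZ_le /=.
have [->|a0] := eqVneq a 0; first by rewrite normr0 mul0r bfam_norm_ge0.
rewrite -ler_pdivlMl ?normr_gt0// -normfV.
by rewrite -{1}[x]scale1r -(mulVf a0) -scalerA bfam_normZ_le.
Qed.

HB.instance Definition _ :=
  Lmodule_isNormed.Build R bfam bfam_normD bfam_normZ bfam_norm0_eq0.

Lemma bfam_normE (x : bfam) : `|x| = sup (range (fun i => `|x i|)).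
Proof. by []. Qed.

Definition to_bfam (f : forall i, X i) : bfam :=
  if pselect (exists M : R, forall i, `|f i| <= M) is left fP then Bfam fP else 0.

Lemma to_bfamE (f : forall i, X i) :
  (exists M : R, forall i, `|f i| <= M) -> forall i, to_bfam f i = f i.
Proof. by move=> fM i; rewrite /to_bfam; case: pselect. Qed.

End BoundedFamilies.

Arguments bfam {R T} X.
Arguments Bfam {R T X} bfun.
Arguments bfun {R T X} b i.

Section Time.
Context {R : realType}.

Fact nneg_subproof (r : R) : 0 <= Num.max 0 r.
Proof. by rewrite le_max lexx. Qed.

(* The retraction of the line onto the half-line; it lets functions of a
   nonnegative time be used with the topology of [R]. *)
Definition nneg (r : R) : {nonneg R} := NngNum (nneg_subproof r).

Definition tadd (s t : {nonneg R}) : {nonneg R} := (s%:num + t%:num)%:nng.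

Lemma nnegK (t : {nonneg R}) : nneg t%:num = t.
Proof. by apply/val_inj => /=; rewrite max_r. Qed.

Lemma nnegE (r : R) : 0 <= r -> (nneg r)%:num = r.
Proof. by move=> r0 /=; rewrite max_r. Qed.

End Time.

Section PiecewiseContinuous.
Context {R : realType} {Y : normedModType R}.

(* [f \o nneg] extends [f] to the line by the constant [f 0]: its continuity
   and its one-sided limits are those of [f] on the half-line.  No one-sided
   continuity is required at the discontinuities, so that the class is stable
   under the concatenation below, which keeps [u1 t] at the switching time. *)
Definition piecewise_continuous (f : {nonneg R} -> Y) : Prop :=
  (forall T : R, finite_set [set t | t <= T /\ ~ {for t, continuous (f \o nneg)}])
  /\ (forall t : R, cvg ((f \o nneg) r @[r --> t^'-]) /\
                    cvg ((f \o nneg) r @[r --> t^'+])).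

Lemma pc0 : piecewise_continuous (fun=> 0).
Proof.
split=> [T|t]; last by split; exact: is_cvg_cst.
rewrite [X in finite_set X](_ : _ = set0)//.
by apply/seteqP; split=> // t [_]; apply; exact: cvg_cst.
Qed.

Lemma pcZD (a : R) (f g : {nonneg R} -> Y) :
  piecewise_continuous f -> piecewise_continuous g ->
  piecewise_continuous (fun t => a *: f t + g t).
Proof.
move=> [fd fl] [gd gl]; split=> [T|t].
  apply: (@sub_finite_set _ _ ([set t | t <= T /\ ~ {for t, continuous (f \o nneg)}]
     `|` [set t | t <= T /\ ~ {for t, continuous (g \o nneg)}])).
    move=> t [tT nc]; apply: contrapT => /not_orP[/not_andP[//|/contrapT fc]].
    move=> /not_andP[//|/contrapT gc]; apply: nc.
    by apply: cvgD => //; apply: cvgZr.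
  by rewrite finite_setU; split.
have [fll flr] := fl t; have [gll glr] := gl t.
by split; apply: is_cvgD => //; exact: is_cvgZr.
Qed.

End PiecewiseContinuous.

Section PCb.
Context {R : realType} (Y : normedModType R).

Definition pc_pred : {pred bfam (fun _ : {nonneg R} => Y)} :=
  fun f => `[< piecewise_continuous f >].

Fact pc_submod_closed : submod_closed pc_pred.
Proof.
split; first by apply/asboolP; exact: pc0.
by move=> a f g /asboolP fp /asboolP gp; apply/asboolP; exact: pcZD.
Qed.

HB.instance Definition _ := GRing.isSubmodClosed.Build _ _ pc_pred pc_submod_closed.

Record pcb := Pcb { pcb_val :> bfam (fun _ : {nonneg R} => Y);
                    _ : pcb_val \in pc_pred }.

HB.instance Definition _ := [isSub for pcb_val].
HB.instance Definition _ := [Choice of pcb by <:].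
HB.instance Definition _ := [SubChoice_isSubLmodule of pcb by <:].

Fact pcb_normD (f g : pcb) : `|val (f + g)| <= `|val f| + `|val g|.
Proof. by rewrite raddfD ler_normD. Qed.
Fact pcb_normZ a (f : pcb) : `|val (a *: f)| = `|a| * `|val f|.
Proof. by rewrite linearZ normrZ. Qed.
Fact pcb_norm0_eq0 (f : pcb) : `|val f| = 0 -> f = 0.
Proof. by move=> /normr0_eq0 f0; apply: val_inj; rewrite f0 raddf0. Qed.

HB.instance Definition _ :=
  Lmodule_isNormed.Build R pcb pcb_normD pcb_normZ pcb_norm0_eq0.

Lemma pcb_normE (f : pcb) : `|f| = sup (range (fun t => `|f t|)).
Proof. by []. Qed.

Lemma pcbP (f : pcb) : piecewise_continuous f.
Proof. by case: f => f fP /=; apply/asboolP. Qed.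

Lemma pcb_ex (f : {nonneg R} -> Y) : (exists M : R, forall t, `|f t| <= M) ->
  piecewise_continuous f -> exists g : pcb, forall t, g t = f t.
Proof.
move=> fb fp; have fP : Bfam f fb \in pc_pred by apply/asboolP.
by exists (Pcb fP).
Qed.

End PCb.


Section PCbInputs.
Context {R : realType} {Y : normedModType R}.
Implicit Types (f g : {nonneg R} -> Y).

Let cvg_at_right_shift (t c : R) : r + c @[r --> t^'+] --> (t + c)^'+.
Proof.
move=> P /nbhs_right0P HP; apply/nbhs_right0P.
by apply: filterS HP => e; rewrite addrAC.
Qed.

Let cvg_at_left_shift (t c : R) : r + c @[r --> t^'-] --> (t + c)^'-.
Proof.
move=> P /nbhs_left0P HP; apply/nbhs_left0P.
by apply: filterS HP => e; rewrite addrAC.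
Qed.

Let is_cvg_near (F : set_system R) (FF : Filter F) (u v : R -> Y) :
  (\forall r \near F, u r = v r) -> cvg (u r @[r --> F]) -> cvg (v r @[r --> F]).
Proof. by move=> uv cu; apply: cvgP (cvg_trans (near_eq_cvg uv) cu). Qed.

Let continuous_near (t : R) (u v : R -> Y) :
  (\forall r \near t, u r = v r) -> {for t, continuous u} -> {for t, continuous v}.
Proof.
move=> uv cu; rewrite /prop_for /continuous_at -(nbhs_singleton uv).
exact: cvg_trans (near_eq_cvg uv) cu.
Qed.

Let is_cvg_right_shift (t c : R) (u : R -> Y) :
  cvg (u r @[r --> (t + c)^'+]) -> cvg (u (r + c) @[r --> t^'+]).
Proof.
move=> cu; apply: cvgP; exact: cvg_comp _ _ (@cvg_at_right_shift t c) cu.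
Qed.

Let is_cvg_left_shift (t c : R) (u : R -> Y) :
  cvg (u r @[r --> (t + c)^'-]) -> cvg (u (r + c) @[r --> t^'-]).
Proof.
move=> cu; apply: cvgP; exact: cvg_comp _ _ (@cvg_at_left_shift t c) cu.
Qed.

Let continuous_shift (t c : R) (u : R -> Y) :
  {for t + c, continuous u} -> {for t, continuous (fun r => u (r + c))}.
Proof.
move=> cu; apply: (@continuous_comp _ _ _ (fun r => r + c) u) => //.
by apply: cvgD; [exact: cvg_id|exact: cvg_cst].
Qed.

Lemma pc_shift f (tau : {nonneg R}) :
  piecewise_continuous f -> piecewise_continuous (fun s => f (tadd s tau)).
Proof.
move=> [fd fl]; set g := (fun s => f (tadd s tau)).
have pos r : 0 <= r -> (f \o nneg) (r + tau%:num) = (g \o nneg) r.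
  move=> r0; rewrite /g /=; congr f; apply: val_inj => /=.
  by rewrite !max_r// addr_ge0.
have neg r : r < 0 -> (g \o nneg) 0 = (g \o nneg) r.
  move=> r0; rewrite /g /=; congr (f (tadd _ _)); apply: val_inj => /=.
  by rewrite maxxx max_l// ltW.
have cst0 : \forall r \near (0 : R)^'-, (g \o nneg) 0 = (g \o nneg) r.
  by near=> r; apply: neg; near: r; exact: nbhs_left_lt.
split=> [T|t].
  apply: (@sub_finite_set _ _ ([set 0] `|` (fun r => r - tau%:num) @`
    [set t | t <= T + tau%:num /\ ~ {for t, continuous (f \o nneg)}])).
    move=> t [tT nc]; have [t0|t0|->] := ltgtP t 0; last by left.
    - exfalso; apply: nc; apply: (@continuous_near t (fun=> (g \o nneg) 0)).
        by near=> r; apply: neg; near: r; exact: lt_nbhsl.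
      exact: cvg_cst.
    - right; exists (t + tau%:num); last by rewrite addrK.
      split; first by rewrite lerD2r.
      move=> /continuous_shift cf; apply: nc; apply: continuous_near cf.
      by near=> r; apply: pos; apply: ltW; near: r; exact: lt_nbhsr.
  by rewrite finite_setU; split => //; exact: finite_image.
split.
- have [t0|t0] := leP t 0.
    apply: (@is_cvg_near _ _ (fun=> (g \o nneg) 0)); last exact: is_cvg_cst.
    near=> r; apply: neg; apply: lt_le_trans t0; near: r; exact: nbhs_left_lt.
  have [+ _] := fl (t + tau%:num) => /is_cvg_left_shift; apply: is_cvg_near.
  by near=> r; apply: pos; near: r; exact: nbhs_left_ge.
- have [t0|t0] := ltP t 0.
    apply: (@is_cvg_near _ _ (fun=> (g \o nneg) 0)); last exact: is_cvg_cst.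
    by near=> r; apply: neg; near: r; exact: nbhs_right_lt.
  have [_ +] := fl (t + tau%:num) => /is_cvg_right_shift; apply: is_cvg_near.
  near=> r; apply: pos; apply: le_trans t0 _; near: r; exact: nbhs_right_ge.
Unshelve. all: by end_near. Qed.

Lemma pc_concat f g (t0 : {nonneg R}) : 0 < t0%:num ->
  piecewise_continuous f -> piecewise_continuous g ->
  piecewise_continuous (fun s : {nonneg R} =>
    if s%:num <= t0%:num then f s else g (nneg (s%:num - t0%:num))).
Proof.
move=> t0_gt0 [fd fl] [gd gl].
set h := (fun s : {nonneg R} =>
  if s%:num <= t0%:num then f s else g (nneg (s%:num - t0%:num))).
have lo r : r <= t0%:num -> (f \o nneg) r = (h \o nneg) r.
  move=> rt; rewrite /h /= ifT// ge_max rt andbT; exact: ltW.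
have hi r : t0%:num < r -> (g \o nneg) (r - t0%:num) = (h \o nneg) r.
  move=> rt; have r0 : 0 < r by exact: lt_trans rt.
  by rewrite /h /= max_r ?(ltW r0)// leNgt rt.
split=> [T|t].
  apply: (@sub_finite_set _ _ (([set t0%:num] `|`
      [set t | t <= T /\ ~ {for t, continuous (f \o nneg)}]) `|`
    (fun r => r + t0%:num) @`
    [set t | t <= T - t0%:num /\ ~ {for t, continuous (g \o nneg)}])).
    move=> t [tT nc]; have [tt|tt|->] := ltgtP t t0%:num; last by left; left.
    - left; right; split=> // cf; apply: nc; apply: continuous_near cf.
      by near=> r; apply: lo; apply: ltW; near: r; exact: lt_nbhsl.
    - right; exists (t - t0%:num); last by rewrite subrK.
      split; first by rewrite lerD2r.
      move=> /continuous_shift cg; apply: nc; apply: continuous_near cg.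
      by near=> r; apply: hi; near: r; exact: lt_nbhsr.
  by rewrite !finite_setU; split; [split|exact: finite_image].
split.
- have [tt|tt] := leP t t0%:num.
    have [+ _] := fl t; apply: is_cvg_near.
    near=> r; apply: lo; apply: le_trans tt; near: r; exact: nbhs_left_le.
  have [+ _] := gl (t - t0%:num) => /is_cvg_left_shift; apply: is_cvg_near.
  by near=> r; apply: hi; near: r; exact: nbhs_left_gt.
- have [tt|tt] := ltP t t0%:num.
    have [_ +] := fl t; apply: is_cvg_near.
    by near=> r; apply: lo; near: r; exact: nbhs_right_le.
  have [_ +] := gl (t - t0%:num) => /is_cvg_right_shift; apply: is_cvg_near.
  near=> r; apply: hi; apply: le_lt_trans tt _; near: r; exact: nbhs_right_gt.
Unshelve. all: by end_near. Qed.

Fact pcb_shift_subproof (tau : {nonneg R}) (f : pcb Y) :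
  exists g : pcb Y, forall s, g s = f (tadd s tau).
Proof.
apply: pcb_ex; last exact/pc_shift/pcbP.
by have [M fM] := bfunP f; exists M => t; exact: fM.
Qed.

Definition pcb_shift (tau : {nonneg R}) (f : pcb Y) : pcb Y :=
  projT1 (cid (pcb_shift_subproof tau f)).

Lemma pcb_shiftE tau (f : pcb Y) s : pcb_shift tau f s = f (tadd s tau).
Proof. exact: (projT2 (cid (pcb_shift_subproof tau f))). Qed.

Lemma pcb_shift_norm tau (f : pcb Y) : `|pcb_shift tau f| <= `|f|.
Proof.
apply: bfam_norm_le; first exact: normr_ge0.
by move=> s; rewrite [X in `|X|]pcb_shiftE; exact: le_bfam_norm.
Qed.

Lemma pcb_concat (f1 f2 : pcb Y) (t : {nonneg R}) : 0 < t%:num ->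
  exists f : pcb Y, (forall s, s%:num <= t%:num -> f s = f1 s) /\
                    (forall s, 0 < s%:num -> f (tadd t s) = f2 s).
Proof.
move=> t0; have [|f fE] := pcb_ex _ (pc_concat t0 (pcbP f1) (pcbP f2)).
  have [M fM] := bfunP f1; have [N fN] := bfunP f2.
  exists (Num.max M N) => s; rewrite le_max; case: ifP => _.
    by rewrite fM.
  by rewrite fN orbT.
exists f; split=> s hs; rewrite fE ?hs//= ifF; last first.
  by apply/negbTE; rewrite -ltNge ltrDl.
by congr (bfun f2 _); apply: val_inj; rewrite /= addrAC subrr add0r max_r.
Qed.

End PCbInputs.

(* A normed space of inputs: [ev] identifies the abstract normed space [inputs]
   with a linear subspace of the maps from the half-line to [ivalues]. *)
Record inputSpace (R : realType) := InputSpace {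
  ivalues : lmodType R;
  inputs :> normedModType R;
  ev : inputs -> {nonneg R} -> ivalues;
  ev_linear : forall (a : R) (u v : inputs) (t : {nonneg R}),
    ev (a *: u + v) t = a *: ev u t + ev v t;
  ev_inj : forall u v : inputs, (forall t, ev u t = ev v t) -> u = v;
  ishift : {nonneg R} -> inputs -> inputs;
  ev_shift : forall (tau : {nonneg R}) (u : inputs) (s : {nonneg R}),
    ev (ishift tau u) s = ev u (tadd s tau);
  shift_norm : forall (tau : {nonneg R}) (u : inputs), `|ishift tau u| <= `|u|;
  concatenable : forall (u1 u2 : inputs) (t : {nonneg R}), 0 < t%:num ->
    exists u : inputs, (forall s, s%:num <= t%:num -> ev u s = ev u1 s) /\
                       (forall s, 0 < s%:num -> ev u (tadd t s) = ev u2 s) }.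

Arguments ev {R i} u t.
Arguments ishift {R i} tau u.

Section ProductInputs.
Context {R : realType} (Y : normedModType R) (U : inputSpace R).

Let P : normedModType R := (pcb Y * U)%type.
Let evP (p : P) (t : {nonneg R}) : Y * ivalues U := (p.1 t, ev p.2 t).
Let shiftP tau (p : P) : P := (pcb_shift tau p.1, ishift tau p.2).

Fact prod_ev_linear (a : R) (p q : P) t : evP (a *: p + q) t = a *: evP p t + evP q t.
Proof.
case: p q => [f u] [g v]; rewrite /evP /=; congr pair; exact: ev_linear.
Qed.

Fact prod_ev_inj (p q : P) : (forall t, evP p t = evP q t) -> p = q.
Proof.
case: p q => [f u] [g v] pq; congr pair.
  by apply: val_inj; apply: bfam_ext => t; have [] := pq t.
by apply: ev_inj => t; have [] := pq t.
Qed.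

Fact prod_ev_shift tau (p : P) s : evP (shiftP tau p) s = evP p (tadd s tau).
Proof. by rewrite /evP /= pcb_shiftE ev_shift. Qed.

Fact prod_shift_norm tau (p : P) : `|shiftP tau p| <= `|p|.
Proof.
by rewrite !prod_normE ge_max !le_max pcb_shift_norm shift_norm orbT.
Qed.

Fact prod_concatenable (p q : P) (t : {nonneg R}) : 0 < t%:num ->
  exists r : P, (forall s, s%:num <= t%:num -> evP r s = evP p s) /\
                (forall s, 0 < s%:num -> evP r (tadd t s) = evP q s).
Proof.
move=> t0; have [f [f1 f2]] := pcb_concat p.1 q.1 t0.
have [u [u1 u2]] := concatenable p.2 q.2 t0.
exists (f, u); split=> s hs; rewrite /evP /=.
  by rewrite f1// u1.
by rewrite f2// u2.
Qed.

(* [PC_b(R_+, Y) x U]; the norm of the product type is the maximum, see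
   [prod_normE]. *)
Definition prod_inputs : inputSpace R :=
  InputSpace prod_ev_linear prod_ev_inj prod_ev_shift prod_shift_norm
    prod_concatenable.

End ProductInputs.

Section ComparisonFunctions.
Context {R : realType}.

(* Functions on the half-line are represented by functions on [R], of which
   only the restriction to nonnegative arguments matters.  Nonnegativity of the
   values on the half-line follows from the monotonicity and limit conditions. *)
Definition class_K (g : R -> R) : Prop :=
  [/\ {within [set r | 0 <= r], continuous g},
      (forall r s, 0 <= r -> r < s -> g r < g s) & g 0 = 0].

Definition class_Kinfty (g : R -> R) : Prop :=
  class_K g /\ (forall M : R, exists2 r : R, 0 <= r & M < g r).

Definition class_K0 (g : R -> R) : Prop :=
  class_K g \/ (forall r, 0 <= r -> g r = 0).

Definition class_L (g : R -> R) : Prop :=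
  [/\ {within [set t | 0 <= t], continuous g},
      (forall s t, 0 <= s -> s < t -> g t < g s) & g t @[t --> +oo] --> (0 : R)].

Definition class_KL (b : R -> R -> R) : Prop :=
  [/\ {within [set p : R * R | 0 <= p.1 /\ 0 <= p.2],
         continuous (fun p : R * R => b p.1 p.2)},
      (forall t, 0 <= t -> class_K (fun r => b r t)) &
      (forall r, 0 < r -> class_L (b r))].

End ComparisonFunctions.

Section ControlSystems.
Context {R : realType}.

(* A partial map from [R_+ x X x U] to [X]; the values of [tr_map] outside
   [tr_dom] are irrelevant. *)
Record transition (X : normedModType R) (U : inputSpace R) := Transition {
  tr_dom : {nonneg R} -> X -> U -> Prop;
  tr_map : {nonneg R} -> X -> U -> X }.

Section System.
Context {X : normedModType R} {U : inputSpace R}.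
Implicit Types p q : transition X U.

Definition tr_extends p q : Prop := forall t x u,
  tr_dom p t x u -> tr_dom q t x u /\ tr_map q t x u = tr_map p t x u.

Definition tr_equal p q : Prop := tr_extends p q /\ tr_extends q p.

Definition tmax p (x : X) (u : U) : \bar R :=
  ereal_sup [set (t%:num)%:E | t in [set t : {nonneg R} | tr_dom p t x u]].

(* In the cocycle property, the equality of values of the partial map includes
   that its left-hand side is defined. *)
Record control_system p : Prop := ControlSystem {
  cs_domain : forall x u, (0 < tmax p x u)%E /\
    (forall t : {nonneg R}, tr_dom p t x u <-> ((t%:num)%:E < tmax p x u)%E);
  cs_init : forall x u, tr_map p 0%:nng x u = x;
  cs_causal : forall t x u v, tr_dom p t x u ->
    (forall s : {nonneg R}, s%:num <= t%:num -> ev u s = ev v s) ->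
    (forall s : {nonneg R}, s%:num <= t%:num -> tr_dom p s x v) /\
    tr_map p t x u = tr_map p t x v;
  cs_continuous : forall x u,
    {within [set r : R | 0 <= r /\ (r%:E < tmax p x u)%E],
      continuous (fun r => tr_map p (nneg r) x u)};
  cs_cocycle : forall t h x u,
    (forall s : {nonneg R}, s%:num <= t%:num + h%:num -> tr_dom p s x u) ->
    tr_dom p h (tr_map p t x u) (ishift t u) /\
    tr_map p h (tr_map p t x u) (ishift t u) = tr_map p (tadd t h) x u }.

Definition forward_complete p : Prop := forall t x u, tr_dom p t x u.

Definition BIC p : Prop := forall x u, (tmax p x u < +oo)%E ->
  forall M : R, 0 < M -> exists t, tr_dom p t x u /\ M < `|tr_map p t x u|.

Definition ISS p : Prop :=
  exists (beta : R -> R -> R) (gamma : R -> R),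
    [/\ class_KL beta, class_K0 gamma &
      forall t x u, tr_dom p t x u ->
        `|tr_map p t x u| <= beta `|x| t%:num + gamma `|u|].

End System.

Section Interconnection.
Context {I : Type} (X : I -> normedModType R) (U : inputSpace R).

Definition other (i : I) : Type := {j : I | j <> i}.

Definition Xne (i : I) : normedModType R :=
  bfam (fun j : other i => X (proj1_sig j)).

Definition subinputs (i : I) : inputSpace R := prod_inputs (Xne i) U.

Variable S : forall i, transition (X i) (subinputs i).

(* In the second condition, [w] is a globally bounded piecewise continuous
   function that coincides with [phi_{<> i}] on [[0, t]]; by causality of [S i]
   the condition does not depend on which one is taken. *)
Definition interconnection_map (p : transition (bfam X) U) : Prop :=
  (forall x u, exists2 e : R, 0 < e &
     forall t : {nonneg R}, t%:num <= e -> tr_dom p t x u) /\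
  (forall t x u, tr_dom p t x u -> forall i, exists w : pcb (Xne i),
     [/\ (forall s : {nonneg R}, s%:num <= t%:num -> tr_dom p s x u /\
            forall j : other i, w s j = tr_map p s x u (proj1_sig j)),
         tr_dom (S i) t (x i) (w, u) &
         tr_map p t x u i = tr_map (S i) t (x i) (w, u)]).

Definition maximal_interconnection_map (p : transition (bfam X) U) : Prop :=
  interconnection_map p /\
  (forall q, interconnection_map q -> tr_extends p q -> tr_extends q p).

Definition well_defined_interconnection (p : transition (bfam X) U) : Prop :=
  [/\ maximal_interconnection_map p,
      (forall q, maximal_interconnection_map q -> tr_equal q p),
      control_system p & BIC p].

(* The supremum over [j] is taken over the terms with [j <> i] together with
   the value 0 of the term [j = i]. *)
Definition ISS_semimax (i : I) (beta : R -> R -> R) (gam : I -> R -> R)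
    (gamu : R -> R) : Prop :=
  [/\ forward_complete (S i),
      class_KL beta,
      (forall j, class_K0 (gam j)) /\ class_K0 gamu,
      (forall r, 0 <= r -> has_ubound (range (fun j => gam j r))) /\
        (forall r, 0 <= r -> gam i r = 0) &
      forall (x : X i) (w : pcb (Xne i)) (u : U) (t : {nonneg R}),
        `|tr_map (S i) t x (w, u)| <=
          beta `|x| t%:num
          + sup ([set 0] `|` range (fun j : other i => gam (proj1_sig j)
              (sup [set `|w s j| | s in [set s : {nonneg R} | s%:num <= t%:num]])))
          + gamu `|u|].

End Interconnection.

End ControlSystems.

Section MonotoneLimit.
Context {R : realType}.

(* [P] is the positive cone, so that [x <= y] reads [P (y - x)]; only the
   values of [A] on [P] matter. *)
Definition MLIM (V : normedModType R) (P : set V) (A : V -> V) : Prop :=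
  exists2 xi : R -> R, class_Kinfty xi &
    forall (e : R) (w : V) (x : nat -> V), 0 < e -> P w ->
      (forall k, P (x k)) ->
      (forall k, P (A (x k) + w - x k.+1)) ->
      (forall k, P (x k - x k.+1)) ->
      exists N, `|x N| <= e + xi `|w|.

Definition linf (I : Type) : normedModType R := bfam (fun _ : I => R^o).

Definition linf_pos (I : Type) : set (linf I) := [set s | forall i, 0 <= s i].

(* By [gain_opE] and [gain_op_pos], this is the intended operator on the cone as
   soon as the gains are uniformly bounded. *)
Definition gain_op (I : Type) (gam : I -> I -> R -> R) (s : linf I) : linf I :=
  to_bfam (fun i => sup (range (fun j => gam i j (s j))) : R^o).

Lemma class_K0_ge0 (g : R -> R) r : class_K0 g -> 0 <= r -> 0 <= g r.
Proof.
move=> [[_ gi g0]|g0] r0; last by rewrite g0.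
by have [->|rn0] := eqVneq r 0; [rewrite g0|rewrite -g0 ltW// gi// lt0r rn0].
Qed.

Lemma class_K0_le (g : R -> R) r s : class_K0 g -> 0 <= r -> r <= s -> g r <= g s.
Proof.
move=> gK r0 rs; have s0 := le_trans r0 rs.
case: gK => [[_ gi g0]|g0]; last by rewrite !g0.
by move: rs; rewrite le_eqVlt => /orP[/eqP->//|rs]; apply/ltW/gi.
Qed.

Section GainOperator.
Context {I : Type} (gam : I -> I -> R -> R).
Hypothesis gamK : forall i j, class_K0 (gam i j).
Hypothesis gam_bounded : forall r, 0 < r ->
  has_ubound [set gam ij.1 ij.2 r | ij in [set: I * I]].

Lemma gain_op_bounded (s : linf I) : linf_pos s ->
  exists2 M : R, 0 <= M & forall i j, gam i j (s j) <= M.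
Proof.
move=> s0; have s1 : 0 < 1 + `|s| by rewrite ltr_pwDl.
have [M gM] := gam_bounded s1.
exists `|M| => // i j.
apply: le_trans (ler_norm M); apply: (@le_trans _ _ (gam i j (1 + `|s|))); last first.
  by apply: gM; exists (i, j).
apply: class_K0_le => //.
apply: (@le_trans _ _ `|s|); last by rewrite lerDr.
by apply: le_trans (le_bfam_norm s j); exact: ler_norm.
Qed.

Lemma gain_opE (s : linf I) i : linf_pos s ->
  has_ubound (range (fun j => gam i j (s j))) /\
  gain_op gam s i = sup (range (fun j => gam i j (s j))).
Proof.
move=> s0; have [M M0 gM] := gain_op_bounded s0; split.
  by exists M => _ [j _ <-].
rewrite /gain_op to_bfamE//; exists M => k.
have ne : range (fun j => gam k j (s j)) !=set0 by exists (gam k i (s i)), i.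
rewrite ger0_norm; first by apply: ge_sup => // _ [j _ <-].
apply: le_trans (class_K0_ge0 (gamK k i) (s0 i)) _.
by apply: ub_le_sup; [exists M => _ [j _ <-]|exists i].
Qed.

Lemma gain_op_pos (s : linf I) : linf_pos s -> linf_pos (gain_op gam s).
Proof.
move=> s0 i; have [ub ->] := gain_opE i s0.
apply: le_trans (class_K0_ge0 (gamK i i) (s0 i)) _.
by apply: ub_le_sup => //; exists i.
Qed.

End GainOperator.

End MonotoneLimit.

Arguments linf_pos {R} I.

(* Main.v *)
(* With [Gamma = gain_op gam] and time [0] as initial time, the componentwise
   suprema [z] of a trajectory satisfy [z <= Gamma z + c] for a constant [c]
   determined by [|x|] and [|u|]; applied to the constant sequence [z], the MLIM
   property bounds [z], and BIC gives forward completeness.  Restarting the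
   trajectories at the times [k h], where [h] is so large that the transient
   terms are dominated by the input terms, makes the suprema over the tails of
   all trajectories with [|x| <= r] and [|u| <= q] a decreasing solution of the
   discrete-time system; MLIM now bounds such trajectories, uniformly, by a gain
   of [q] up to [e] after some time.  A geometric grid of values of [q] replaces
   [q] by [|u|], and the excess over the gain of [|u|] is dominated by a KL
   function, which can be chosen as a product of a function of [|x|] and one of
   [t]. *)

Require Import Defs.
From mathcomp Require Import all_boot all_order all_algebra.
From mathcomp Require Import all_classical all_reals all_analysis.
From mathcomp Require Import lra.

Set Implicit Arguments.
Unset Strict Implicit.
Unset Printing Implicit Defensive.

Import Order.TTheory GRing.Theory Num.Theory.
Import numFieldNormedType.Exports.

Local Open Scope classical_set_scope.
Local Open Scope ring_scope.

(** * Comparison functions and the construction of KL majorants *)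

Section ComparisonFunctions.
Context {R : realType}.
Implicit Types (g h : R -> R) (r s t : R).

(** Precomposing with the retraction [Num.max 0] trades continuity within the half-line for
    continuity on the line, where the rules for sums, products and composites apply directly. *)
Lemma continuous_max0P g : {within [set r | 0 <= r], continuous g} <->
  continuous (fun r => g (Num.max 0 r)).
Proof.
split=> [/subspace_continuousP cg r|cg].
  have r0 : 0 <= Num.max 0 r by rewrite le_max lexx.
  apply: (@cvg_comp _ _ _ (fun r => Num.max 0 r) g _ _ _ _ (cg _ r0)).
  move=> P /= wP; have cm : {for r, continuous (fun r => Num.max 0 r)}.
    by apply: continuous_max; [exact: cvg_cst|exact: cvg_id].
  have cP : \forall s \near r, 0 <= Num.max 0 s -> P (Num.max 0 s) by exact: (cm _ wP).
  apply: (@filterS _ (nbhs r) _ _ _ _ cP) => s; apply.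
  by rewrite le_max lexx.
apply: (@subspace_eq_continuous _ _ _ (fun r => g (Num.max 0 r))); last first.
  exact: continuous_subspaceT.
by move=> r; rewrite inE /= => r0; rewrite max_r.
Qed.

Lemma class_K_ge0 g r : class_K g -> 0 <= r -> 0 <= g r.
Proof. by move=> gK; apply: class_K0_ge0; left. Qed.

Lemma class_K_gt0 g r : class_K g -> 0 < r -> 0 < g r.
Proof. by move=> [_ gi g0] r0; rewrite -g0 gi. Qed.

Lemma class_K_le g r s : class_K g -> 0 <= r -> r <= s -> g r <= g s.
Proof. by move=> gK; apply: class_K0_le; left. Qed.

Lemma class_K_comp g h : class_K g -> class_K h -> class_K (g \o h).
Proof.
move=> gK hK; have [/continuous_max0P gc gi g0] := gK.
have [/continuous_max0P hc hi h0] := hK; split.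
- apply/continuous_max0P => r /=.
  rewrite (_ : (fun _ => _) =
      (fun r => g (Num.max 0 r)) \o (fun r => h (Num.max 0 r))).
    by apply: continuous_comp; [exact: hc|exact: gc].
  apply/funext => s /=; have hs : 0 <= h (Num.max 0 s).
    by rewrite class_K_ge0// le_max lexx.
  by rewrite (max_r hs).
- by move=> r s r0 rs /=; rewrite gi ?hi// class_K_ge0.
- by rewrite /= h0.
Qed.

Lemma class_KD g h : class_K g -> class_K h -> class_K (fun r => g r + h r).
Proof.
move=> [/continuous_max0P gc gi g0] [/continuous_max0P hc hi h0]; split.
- by apply/continuous_max0P => r; apply: cvgD; [exact: gc|exact: hc].
- by move=> r s r0 rs; rewrite ltrD ?gi ?hi.
- by rewrite g0 h0 addr0.
Qed.

Lemma class_K_id : class_K (@id R).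
Proof. by split=> //; apply: continuous_subspaceT => r; exact: cvg_id. Qed.

Lemma class_KL_le (b : R -> R -> R) r s t u : class_KL b ->
  0 <= r -> r <= s -> 0 <= t -> t <= u -> b r u <= b s t.
Proof.
move=> [_ bK bL] r0 rs t0 tu; apply: le_trans (class_K_le (bK t t0) r0 rs).
(* Decrease in time is given for positive [r]; at [r = 0] both sides vanish. *)
have [<-//|rn0] := eqVneq 0 r.
  have u0 := le_trans t0 tu.
  by have [_ _ ->] := bK u u0; have [_ _ ->] := bK t t0.
have /bL[_ bi _] : 0 < r by rewrite lt_neqAle rn0.
by move: tu; rewrite le_eqVlt => /orP[/eqP->//|tu]; apply/ltW/bi.
Qed.

Lemma class_KL_small (b : R -> R -> R) r e : class_KL b -> 0 < r -> 0 < e ->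
  exists2 t, 0 < t & b r t <= e.
Proof.
move=> [_ _ bL] r0 e0; have [_ _ /cvgrPdist_le bcvg] := bL r r0.
near (pinfty_nbhs R) => t; exists t.
  by near: t; exact: nbhs_pinfty_gt.
have : `|0 - b r t| <= e by near: t; exact: bcvg.
by rewrite sub0r normrN; apply: le_trans; exact: ler_norm.
Unshelve. all: by end_near. Qed.

Lemma class_K_small g e : class_K g -> 0 < e -> exists2 d, 0 < d & g d <= e.
Proof.
move=> [/continuous_max0P gc _ g0] e0.
have /cvgrPdist_le/(_ e e0) := gc 0; rewrite maxxx g0 => gce.
near (0 : R)^'+ => d; exists d; first by near: d; exact: nbhs_right_gt.
have d0 : 0 < d by near: d; exact: nbhs_right_gt.
have : `|0 - g (Num.max 0 d)| <= e by near: d; apply: cvg_within; exact: gce.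
rewrite (max_r (ltW d0)) sub0r normrN; apply: le_trans; exact: ler_norm.
Unshelve. all: by end_near. Qed.

(* The sup-convolution of the data with the kernel [t |-> max 0 t] is
   nonincreasing and 1-Lipschitz. *)
Lemma vanishing_majorant (A : Type) (tau v : A -> R) :
  (forall a, 0 <= v a <= 1) ->
  (forall e, 0 < e -> exists T, forall a, T <= tau a -> v a <= e) ->
  exists h, [/\ continuous h, {homo h : s t /~ s <= t}, (forall t, 0 <= h t),
    h t @[t --> +oo] --> 0 & forall a, v a <= h (tau a)].
Proof.
move=> v01 vcvg.
(* The added [0] keeps the set nonempty even if [A] is empty, and makes its supremum [h t]
   nonnegative. *)
pose P t := [set 0] `|` range (fun a => v a - Num.max 0 (t - tau a)).
have P0 t : P t !=set0 by exists 0; left.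
have Pub t : has_ubound (P t).
  exists 1 => _ [->//|[a _ <-]]; have /andP[_ v1] := v01 a.
  by rewrite lerBlDr (le_trans v1)// lerDl le_max lexx.
pose h t := sup (P t).
have hle t M : 0 <= M -> (forall a, v a - Num.max 0 (t - tau a) <= M) -> h t <= M.
  by move=> M0 vM; apply: ge_sup => // _ [->//|[a _ <-]].
have h0 t : 0 <= h t by apply: ub_le_sup => //; left.
have hge t a : v a - Num.max 0 (t - tau a) <= h t.
  by apply: ub_le_sup => //; right; exists a.
have hlip s t : h t <= h s + `|s - t|.
  apply: hle => [|a]; first by rewrite addr_ge0.
  have := hge s a; have := ler_norm (s - t).
  have : Num.max 0 (s - tau a) <= Num.max 0 (t - tau a) + `|s - t|.
    rewrite ge_max addr_ge0 ?le_max ?lexx//=.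
    have : t - tau a <= Num.max 0 (t - tau a) by rewrite le_max lexx orbT.
    by have := ler_norm (s - t); lra.
  lra.
exists h; split => //.
- move=> t; apply/cvgrPdist_le => e e0; near=> s.
  have ste : `|t - s| <= e by near: s; exact: cvgr_dist_le.
  rewrite ler_norml; have := hlip s t; have := hlip t s.
  by rewrite (distrC s); move: ste; set d := `|t - s|; lra.
- move=> s t ts; apply: hle => // a; apply: le_trans (hge t a).
  by rewrite lerD2l lerN2 ge_max le_max lexx/= le_max lerD2r ts orbT.
- apply/cvgrPdist_le => e e0; have [T vT] := vcvg e e0.
  near=> t; rewrite sub0r normrN ger0_norm//; apply: hle; first exact: ltW.
  move=> a; have [Ta|aT] := leP T (tau a).
    by apply: le_trans (vT a Ta); rewrite gerBl le_max lexx.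
  have tT : T + 1 <= t by near: t; apply: nbhs_pinfty_ge; exact: num_real.
  have : 1 <= Num.max 0 (t - tau a) by rewrite le_max; apply/orP; right; lra.
  by have /andP[_] := v01 a; lra.
- by move=> a; apply: le_trans (hge (tau a) a); rewrite subrr maxxx subr0.
Unshelve. all: by end_near. Qed.

(** Dividing [v] by the weight [d rho] makes the decay uniform in [rho], so that one function [h] of
    [tau] majorizes the quotient. The bound [sigma rho] supplies the vanishing at [rho = 0], which
    [d rho * h tau] lacks. *)
Lemma class_KL_majorant (A : Type) (rho tau v : A -> R) sigma :
  class_K sigma ->
  (forall a, 0 <= rho a) -> (forall a, 0 <= v a) ->
  (forall a, v a <= sigma (rho a)) ->
  (forall r e, 0 < r -> 0 < e ->
    exists T, forall a, rho a <= r -> T <= tau a -> v a <= e) ->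
  exists2 b : R -> R -> R, class_KL b & forall a, v a <= b (rho a) (tau a).
Proof.
move=> sK rho0 v0 vs vcvg; have [/continuous_max0P sc si s0] := sK.
(* The factor [1 + sigma r] bounds the quotient by 1; the factor [1 + r] makes it at most [e] where
   [rho > e^-1], which leaves the range [rho <= e^-1] to the decay hypothesis. *)
pose d r := (1 + r) * (1 + sigma r).
have d1 r : 0 <= r -> 1 <= d r.
  move=> r0; have := class_K_ge0 sK r0; rewrite /d; nra.
have [a|e e0|h [hc hi h0 hcvg vh]] :=
    @vanishing_majorant A tau (fun a => v a / d (rho a)).
- have da := d1 _ (rho0 a); have dp : 0 < d (rho a) by lra.
  rewrite (divr_ge0 (v0 a) (ltW dp)) ler_pdivrMr// mul1r (le_trans (vs a))// /d.
  by have := class_K_ge0 sK (rho0 a); have := rho0 a; nra.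
- have [T vT] := vcvg e^-1 e ltac:(by rewrite invr_gt0) e0; exists T => a Ta.
  have da := d1 _ (rho0 a); have dp : 0 < d (rho a) by lra.
  have sa := class_K_ge0 sK (rho0 a).
  rewrite /= ler_pdivrMr//; have [re|er] := leP (rho a) e^-1.
    by have := vT a re Ta; nra.
  apply: le_trans (vs a) _; rewrite /d mulrA.
  have : 1 <= e * rho a by rewrite mulrC -ler_pdivrMr// mul1r ltW.
  nra.
pose g r := Num.sqrt (sigma r * d r).
(* [h] is only nonincreasing; the exponential makes [k] positive and strictly decreasing. *)
pose k t := Num.sqrt (h t) + expR (- t).
have g0 r : 0 <= g r by exact: sqrtr_ge0.
have k_gt0 t : 0 < k t by rewrite ltr_wpDl ?sqrtr_ge0 ?expR_gt0.
have gc : continuous (fun r => g (Num.max 0 r)).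
  have qc : continuous (fun r => sigma (Num.max 0 r) * d (Num.max 0 r)).
    move=> r; apply: cvgM; first exact: sc.
    apply: cvgM; (apply: cvgD; first exact: cvg_cst); last exact: sc.
    by apply: continuous_max; [exact: cvg_cst|exact: cvg_id].
  by move=> r; apply: (continuous_comp (qc r)); exact: sqrt_continuous.
have gK : class_K g.
  split; first exact/continuous_max0P.
  - move=> r s r0 rs; rewrite /g ltr_sqrt; last first.
      have s_gt0 := le_lt_trans r0 rs; have := class_K_gt0 sK s_gt0.
      by have := d1 s (ltW s_gt0); nra.
    have := si r s r0 rs; have := class_K_ge0 sK r0; rewrite /d => sr ss.
    apply: (@le_lt_trans _ _ (sigma r * ((1 + s) * (1 + sigma s)))).
      by apply: ler_wpM2l => //; nra.
    by rewrite ltr_pM2r//; nra.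
  - by rewrite /g s0 mul0r sqrtr0.
have kc : continuous k.
  move=> t; apply: cvgD.
    by apply: (continuous_comp (hc t)); exact: sqrt_continuous.
  have cN : {for t, continuous (@GRing.opp R)} by apply: cvgN; exact: cvg_id.
  by apply: (continuous_comp cN); exact: continuous_expR.
have ki s t : s < t -> k t < k s.
  move=> st; rewrite /k ler_ltD ?ltr_expR ?ltrN2//.
  by rewrite ler_sqrt ?h0// hi// ltW.
exists (fun r t => g r * k t).
  split.
  - apply: (@subspace_eq_continuous _ _ _ (fun p : R * R => g (Num.max 0 p.1) * k p.2)).
      by move=> p; rewrite inE /= => -[p1 _]; rewrite max_r.
    apply: continuous_subspaceT => p; apply: cvgM.
      apply: (@continuous_comp _ _ _ fst (fun r => g (Num.max 0 r))); last exact: gc.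
      exact: cvg_fst.
    by apply: (@continuous_comp _ _ _ snd k); [exact: cvg_snd|exact: kc].
  - move=> t t0; have [_ gi g00] := gK; split.
    + by apply/continuous_max0P => r; apply: cvgM; [exact: gc|exact: cvg_cst].
    + by move=> r s r0 rs; rewrite ltr_pM2r// gi.
    + by rewrite g00 mul0r.
  - move=> r r0; have gr := class_K_gt0 gK r0; split.
    + by apply: continuous_subspaceT => t; apply: cvgM; [exact: cvg_cst|exact: kc].
    + by move=> s t _ st; rewrite ltr_pM2l// ki.
    + rewrite -(mulr0 (g r)); apply: cvgM; first exact: cvg_cst.
      rewrite -(addr0 0); apply: cvgD; last exact: cvgr_expR.
      rewrite -(sqrtr0 R); apply: (@cvg_comp _ _ _ h (@Num.sqrt R) _ _ _ hcvg).
      exact: sqrt_continuous.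
move=> a; have da := d1 _ (rho0 a); have dp : 0 < d (rho a) by lra.
have sa := class_K_ge0 sK (rho0 a).
apply: (@le_trans _ _ (g (rho a) * Num.sqrt (h (tau a)))); last first.
  by rewrite ler_wpM2l// lerDl expR_ge0.
(* [v] is the geometric mean of itself, bounded by [sigma rho], and of itself,
   bounded by [d rho * h tau]. *)
have sd0 : 0 <= sigma (rho a) * d (rho a) by rewrite mulr_ge0// ltW.
rewrite /g -sqrtrM// -[v a in leLHS](ger0_norm (v0 a)) -sqrtr_sqr.
rewrite (ler_sqrt _ (mulr_ge0 sd0 (h0 _))) expr2 -mulrA ler_pM//.
by have := vh a; rewrite ler_pdivrMr// mulrC.
Qed.

End ComparisonFunctions.

(** * Constants and componentwise suprema in [linf I] *)

Section BoundedFamilies.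
Context {R : realType} {I : Type}.

Fact linf_cst_subproof (c : R) : exists M : R, forall _ : I, `|c : R^o| <= M.
Proof. by exists `|c|. Qed.

Definition linf_cst (c : R) : linf I := Bfam (fun=> c : R^o) (linf_cst_subproof c).

Lemma linf_cst_norm c : 0 <= c -> `|linf_cst c| <= c.
Proof. by move=> c0; apply: bfam_norm_le => // i; rewrite /= ger0_norm. Qed.

Lemma linf_le_norm (z : @linf R I) i : z i <= `|z|.
Proof. exact: le_trans (ler_norm _) (le_bfam_norm z i). Qed.

(** These suprema serve as states of the discrete-time system; the last clause, leastness, turns an
    estimate valid for every trajectory into an inequality for [z]. *)
Lemma linf_sup (X : I -> normedModType R) (T : Type) (P : set T)
    (f : T -> bfam X) (M : R) :
  P !=set0 -> (forall a, P a -> `|f a| <= M) ->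
  exists z : linf I, [/\ linf_pos I z, forall a i, P a -> `|f a i| <= z i &
    forall i c, (forall a, P a -> `|f a i| <= c) -> z i <= c].
Proof.
move=> [a0 Pa0] fM; pose Q i := [set `|f a i| | a in P].
have Q0 i : Q i !=set0 by exists `|f a0 i|, a0.
have fiM a i : P a -> `|f a i| <= M.
  by move=> /fM; apply: le_trans; exact: le_bfam_norm.
have Qub i : has_ubound (Q i) by exists M => _ [a Pa <-]; exact: fiM.
have fQ a i : P a -> `|f a i| <= sup (Q i).
  by move=> Pa; apply: ub_le_sup => //; exists a.
have zM : exists N : R, forall i, `|sup (Q i) : R^o| <= N.
  exists M => i; rewrite ger0_norm; last exact: le_trans (fQ a0 i Pa0).
  by apply: ge_sup => // _ [a Pa <-]; exact: fiM.
exists (Bfam (fun i => sup (Q i) : R^o) zM); split => //= [i|i c fc].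
  exact: le_trans (fQ a0 i Pa0).
by apply: ge_sup => // _ [a Pa <-]; exact: fc.
Qed.

End BoundedFamilies.

(** * Restarted trajectories and the monotone limit property *)

Section SmallGain.
Context {R : realType} {I : Type} {X : I -> normedModType R} {U : inputSpace R}.
Context {Sys : forall i : I, transition (X i) (subinputs X U i)}.
Context {Sigma : transition (bfam X) U}.
Context {beta : I -> R -> R -> R} {gam : I -> I -> R -> R} {gamu : I -> R -> R}.
Context {beta_max : R -> R -> R} {gamma_max : R -> R}.
Hypothesis interconnection : interconnection_map Sys Sigma.
Hypothesis csSigma : control_system Sigma.
Hypothesis semimax : forall i, ISS_semimax Sys i (beta i) (gam i) (gamu i).
Hypothesis beta_maxKL : class_KL beta_max.
Hypothesis gamma_maxK : class_K gamma_max.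
Hypothesis beta_le :
  forall i r t, 0 <= r -> 0 <= t -> beta i r t <= beta_max r t.
Hypothesis gamu_le : forall i r, 0 <= r -> gamu i r <= gamma_max r.
Hypothesis gam_bounded : forall r, 0 < r ->
  has_ubound [set gam ij.1 ij.2 r | ij in [set: I * I]].
Variable xi : R -> R.
Hypothesis xiK : class_K xi.
Hypothesis mlim : forall (e : R) (w : linf I) (x : nat -> linf I),
  0 < e -> linf_pos I w -> (forall k, linf_pos I (x k)) ->
  (forall k, linf_pos I (gain_op gam (x k) + w - x k.+1)) ->
  (forall k, linf_pos I (x k - x k.+1)) ->
  exists N, `|x N| <= e + xi `|w|.

Local Notation phi := (tr_map Sigma).

Let gamK i j : class_K0 (gam i j).
Proof. by have [_ _ [+ _] _ _] := semimax i; apply. Qed.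

(** The cocycle property restarts the trajectory at time [t], and the ISS estimate of the [i]-th
    subsystem applies to the restart: its internal input [w] consists, on the window, of the other
    components, which [z] dominates. *)
Lemma tail_estimate (x : bfam X) (u : U) (t h : {nonneg R}) (z : linf I) i :
  linf_pos I z ->
  (forall s, s%:num <= t%:num + h%:num -> tr_dom Sigma s x u) ->
  (forall (s : {nonneg R}) j, t%:num <= s%:num <= t%:num + h%:num ->
     `|phi s x u j| <= z j) ->
  `|phi (tadd t h) x u i| <=
    beta_max `|phi t x u i| h%:num + gain_op gam z i + gamma_max `|u|.
Proof.
move=> z0 dom zb.
have [domh <-] := cs_cocycle csSigma dom.
have [w [ws _ ->]] := interconnection.2 _ _ _ domh i.
have [_ _ _ _ est] := semimax i.
apply: le_trans (est _ w _ h) _; apply: lerD; first apply: lerD.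
- exact: beta_le.
- have [ub gE] := gain_opE gamK gam_bounded i z0.
  apply: ge_sup => [|_ [->|[j _ <-]]]; first by exists 0; left.
    exact: gain_op_pos.
  rewrite gE; apply: (@le_trans _ _ (gam i (proj1_sig j) (z (proj1_sig j)))).
    2: by apply: ub_le_sup => //; exists (proj1_sig j).
  have w_le s : s%:num <= h%:num -> `|w s j| <= z (proj1_sig j).
    move=> sh; have [_ ->] := ws s sh.
    have [|_ ->] := @cs_cocycle _ _ _ _ csSigma t s x u.
      by move=> s' s't; apply: dom; rewrite (le_trans s't)// lerD2l.
    by apply: zb; rewrite /= lerDl lerD2l sh andbT.
  have wne : [set `|w s j| | s in [set s : {nonneg R} | s%:num <= h%:num]] !=set0.
    by exists `|w 0%:nng j|, 0%:nng => /=.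
  apply: class_K0_le => //; last by apply: ge_sup => // _ [s sh <-]; exact: w_le.
  apply: (@le_trans _ _ `|w 0%:nng j|) => //; apply: ub_le_sup; last first.
    by exists 0%:nng => /=.
  by exists (z (proj1_sig j)) => _ [s sh <-]; exact: w_le.
- apply: le_trans (gamu_le _ _) _ => //.
  by apply: class_K_le => //; exact: shift_norm.
Qed.

(* The constant sequence [z] is a decreasing solution of the discrete-time
   system. *)
Lemma monotone_bounded_invertibility (z : linf I) (c : R) : 0 <= c ->
  linf_pos I z -> (forall i, z i <= gain_op gam z i + c) -> `|z| <= xi c.
Proof.
move=> c0 z0 zle; apply/ler_addgt0Pr => e e0.
have [|||//|_ +] := @mlim e (linf_cst c) (fun=> z) e0.
- by move=> i.
- by [].
- by move=> _ i; rewrite bfamBE bfamDE subr_ge0 zle.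
- by move=> _ i; rewrite subrr.
move=> /le_trans; apply; rewrite addrC lerD2r.
by apply: class_K_le => //; exact: linf_cst_norm.
Qed.

(** * A priori bounds and forward completeness *)

Lemma dom_le (x : bfam X) (u : U) (s t : {nonneg R}) : s%:num <= t%:num ->
  tr_dom Sigma t x u -> tr_dom Sigma s x u.
Proof.
move=> st; have [_ dom] := cs_domain csSigma x u.
by rewrite !dom; apply: le_lt_trans; rewrite lee_fin.
Qed.

(** By continuity on a compact time interval; this makes the componentwise suprema over [[0, t]] an
    element of [linf I]. *)
Lemma trajectory_bounded (x : bfam X) (u : U) (t : {nonneg R}) :
  tr_dom Sigma t x u ->
  exists M : R, forall s : {nonneg R}, s%:num <= t%:num -> `|phi s x u| <= M.
Proof.
have [_ dom] := cs_domain csSigma x u; move=> /dom tmx.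
have cphi : {within `[0, t%:num], continuous (fun r => phi (nneg r) x u)}.
  apply: continuous_subspaceW (cs_continuous csSigma (x := x) (u := u)).
  move=> r /=; rewrite in_itv /= => /andP[r0 rt]; split=> //.
  by apply: le_lt_trans tmx; rewrite lee_fin.
have [//||c _ cmax] := @EVT_max R (fun r => `|phi (nneg r) x u|) 0 t%:num.
  by move=> r; apply: cvg_norm; exact: cphi.
exists `|phi (nneg c) x u| => s st; rewrite -[s in leLHS]nnegK.
by apply: cmax; rewrite in_itv /= st andbT.
Qed.

(** The bound is independent of [t], as BIC requires: the transient is estimated by its value at
    time 0, where it is largest. *)
Lemma state_bound (x : bfam X) (u : U) (t : {nonneg R}) : tr_dom Sigma t x u ->
  `|phi t x u| <= xi (beta_max `|x| 0 + gamma_max `|u|).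
Proof.
move=> domt; have [M phiM] := trajectory_bounded domt.
have [|z [z0 phiz zle]] :=
  @linf_sup _ _ X _ [set s : {nonneg R} | s%:num <= t%:num] _ M _ phiM.
  by exists 0%:nng => /=.
have bK : class_K (beta_max^~ 0) by have [_ + _] := beta_maxKL; apply.
have c0 : 0 <= beta_max `|x| 0 + gamma_max `|u|.
  by rewrite addr_ge0 ?(class_K_ge0 bK) ?class_K_ge0.
have zxi : `|z| <= xi (beta_max `|x| 0 + gamma_max `|u|).
  apply: monotone_bounded_invertibility => // i.
  apply: zle => s st.
  have sE : s = tadd 0%:nng s by apply: val_inj; rewrite /= add0r.
  rewrite [in leLHS]sE; apply: le_trans (tail_estimate i z0 _ _) _.
  - by move=> s'; rewrite add0r => s's; apply: dom_le domt; exact: le_trans st.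
  - by move=> s' j; rewrite add0r => /andP[_ s's]; apply: phiz; exact: le_trans st.
  rewrite (cs_init csSigma) addrAC [leRHS]addrC lerD2r lerD2r.
  by apply: class_KL_le => //; exact: le_bfam_norm.
apply: le_trans zxi; apply: bfam_norm_le => // i.
by apply: le_trans (linf_le_norm z i); apply: phiz => /=.
Qed.

Lemma BIC_forward_complete : BIC Sigma -> forward_complete Sigma.
Proof.
move=> bic t x u; have [_ dom] := cs_domain csSigma x u; apply/dom.
have [/bic|] := ltP (tmax Sigma x u) +oo%E; last first.
  by move=> /(lt_le_trans _); apply; exact: ltry.
set b := xi (beta_max `|x| 0 + gamma_max `|u|).
have b1 : 0 < 1 + `|b| by rewrite ltr_pwDl.
move=> /(_ _ b1)[s [/state_bound phib]].
by rewrite ltNge (le_trans phib)// -/b (le_trans (ler_norm b))// lerDr.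
Qed.

(** * Uniform asymptotic gain and ISS *)

Hypothesis fcSigma : forward_complete Sigma.

(* The suprema of the tails from the times [k h], over all trajectories with
   [|x| <= r] and [|u| <= q], form a decreasing solution of the discrete-time
   system. *)
Lemma ultimate_bound (r q e : R) : 0 < r -> 0 < q -> 0 < e ->
  exists T : R, forall (x : bfam X) (u : U) (t : {nonneg R}),
    `|x| <= r -> `|u| <= q -> T <= t%:num ->
    `|phi t x u| <= e + xi (gamma_max q + gamma_max q).
Proof.
move=> r0 q0 e0; have gq0 := class_K_gt0 gamma_maxK q0.
have bK : class_K (beta_max^~ 0) by have [_ + _] := beta_maxKL; apply.
(* By [state_bound], [K] dominates all states considered; the added 1 makes it positive, as the
   choice of [h] requires. *)
pose K := xi (beta_max r 0 + gamma_max q) + 1.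
have K0 : 0 < K.
  by rewrite ltr_wpDl// class_K_ge0// addr_ge0 ?(class_K_ge0 bK) ?ltW.
have phiK (x : bfam X) (u : U) t : `|x| <= r -> `|u| <= q -> `|phi t x u| <= K.
  move=> xr uq; apply: le_trans (state_bound (fcSigma t x u)) _.
  rewrite /K ler_wpDr// class_K_le ?addr_ge0 ?(class_K_ge0 bK) ?class_K_ge0//.
  by apply: lerD; [exact: (class_K_le bK)|exact: class_K_le].
(* After time [h], the transient from any state of norm at most [K] is at most [gamma_max q]. *)
have [h h0 hb] := class_KL_small beta_maxKL K0 gq0.
pose P (k : nat) := [set a : bfam X * U * {nonneg R} |
  [/\ `|a.1.1| <= r, `|a.1.2| <= q & k%:R * h <= a.2%:num]].
have kh0 (k : nat) : 0 <= k%:R * h by rewrite mulr_ge0 ?ler0n ?ltW.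
have /choice[z zP] : forall k, exists z : linf I, [/\ linf_pos I z,
    forall a i, P k a -> `|phi a.2 a.1.1 a.1.2 i| <= z i &
    forall i c, (forall a, P k a -> `|phi a.2 a.1.1 a.1.2 i| <= c) -> z i <= c].
  move=> k; apply: (@linf_sup _ _ X _ (P k) (fun a => phi a.2 a.1.1 a.1.2) K).
    exists (0, 0, nneg (k%:R * h)); split; rewrite /= ?normr0 ?(ltW r0) ?(ltW q0)//.
    by rewrite le_max lexx orbT.
  by move=> a [xr uq _]; exact: phiK.
have gg0 : 0 <= gamma_max q + gamma_max q by rewrite addr_ge0 ?ltW.
(* One [gamma_max q] pays for the transient after a restart, the other for the external input. *)
have [|||//|N zN] := @mlim e (linf_cst (gamma_max q + gamma_max q)) z e0.
- by move=> i.
- by move=> k; have [] := zP k.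
- move=> k i; rewrite bfamBE bfamDE subr_ge0.
  have [_ _ zle] := zP k.+1; apply: zle => -[[x u] t] [/= xr uq].
  rewrite -natr1 mulrDl mul1r => kt; have [zk0 phiz _] := zP k.
  have tE : t = tadd (nneg (k%:R * h)) (nneg (t%:num - k%:R * h)).
    by apply: val_inj; rewrite /= !max_r ?subrKC//; lra.
  rewrite [in leLHS]tE; apply: le_trans (tail_estimate i zk0 _ _) _.
  + by move=> s _; exact: fcSigma.
  + move=> s j /andP[ks _]; apply: (phiz (x, u, s)); split=> //=.
    by rewrite nnegE in ks.
  + rewrite addrC addrCA addrA addrC lerD2l lerD//; last exact: class_K_le.
    apply: le_trans hb; apply: class_KL_le => //; rewrite ?nnegE; try lra.
    by apply: le_trans (phiK _ _ _ xr uq); exact: le_bfam_norm.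
(* The sets [P k] shrink as [k] grows, hence so do the suprema. *)
- move=> k i; rewrite bfamBE subr_ge0.
  have [_ _ zle] := zP k.+1; apply: zle => a [xr uq kt].
  have [_ phiz _] := zP k; apply: phiz; split=> //; apply: le_trans kt.
  by apply: (ler_wpM2r (ltW h0)); rewrite ler_nat.
exists (N%:R * h) => x u t xr uq Nt.
apply: (@le_trans _ _ `|z N|).
  apply: bfam_norm_le => // i; apply: le_trans (linf_le_norm (z N) i).
  by have [_ phiz _] := zP N; exact: (phiz (x, u, t)).
apply: le_trans zN _; rewrite lerD2l.
by apply: class_K_le => //; exact: linf_cst_norm.
Qed.

(* Between two consecutive points of the grid [r / 2 ^ n], passing from [|u|] to
   the upper one costs a factor at most 2 in the argument of the gain. *)
Lemma uniform_ultimate_bound (r e : R) : 0 < r -> 0 < e ->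
  exists T : R, forall (x : bfam X) (u : U) (t : {nonneg R}),
    `|x| <= r -> `|u| <= r -> T <= t%:num ->
    `|phi t x u| <=
      e + xi (gamma_max (`|u| + `|u|) + gamma_max (`|u| + `|u|)).
Proof.
move=> r0 e0; have gg0 q : 0 <= q -> 0 <= gamma_max q by exact: class_K_ge0.
have xigg0 q : 0 <= q -> 0 <= xi (gamma_max q + gamma_max q).
  by move=> q0; rewrite class_K_ge0// addr_ge0 ?gg0.
have xiggK : class_K (fun q => xi (gamma_max q + gamma_max q)).
  exact: (class_K_comp xiK (class_KD gamma_maxK gamma_maxK)).
have e20 : 0 < e / 2 by rewrite divr_gt0.
(* Inputs of norm at most [d] fall under the bound for [q = d], whose gain costs at most [e / 2];
   finitely many grid points then cover the larger inputs. *)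
have [d d0 de] := class_K_small xiggK e20.
have grid n : exists T : R, forall (x : bfam X) (u : U) (t : {nonneg R}),
    `|x| <= r -> r / 2 ^+ n < `|u| -> `|u| <= r -> T <= t%:num ->
    `|phi t x u| <=
      e + xi (gamma_max (`|u| + `|u|) + gamma_max (`|u| + `|u|)).
  elim: n => [|n [T TP]].
    by exists 0 => x u t _; rewrite expr0 divr1 => /lt_le_trans h /h; rewrite ltxx.
  have q0 : 0 < r / 2 ^+ n by rewrite divr_gt0// exprn_gt0.
  have [T' T'P] := ultimate_bound r0 q0 e0.
  exists (Num.max T T') => x u t xr ru ur; rewrite ge_max => /andP[Tt T't].
  have [uq|qu] := leP `|u| (r / 2 ^+ n); last exact: TP.
  apply: le_trans (T'P _ _ _ xr uq T't) _; rewrite lerD2l.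
  apply: (class_K_le xiggK); first exact: ltW.
  move: ru; rewrite exprSr invfM mulrA; lra.
have [n rn] : exists n, r / 2 ^+ n <= d.
  exists (Num.bound (r / d)); rewrite ler_pdivrMr ?exprn_gt0// mulrC -ler_pdivrMr//.
  have rd0 : 0 <= r / d by rewrite ltW// divr_gt0.
  apply/ltW/(lt_trans (archi_boundP rd0)).
  by rewrite -natrX ltr_nat ltn_expl.
have [T TP] := grid n; have [T' T'P] := ultimate_bound r0 d0 e20.
exists (Num.max T T') => x u t xr ur; rewrite ge_max => /andP[Tt T't].
have [ud|du] := leP `|u| d; last by apply: TP => //; exact: le_lt_trans du.
apply: le_trans (T'P _ _ _ xr ud T't) _.
have := xigg0 (`|u| + `|u|) (addr_ge0 (normr_ge0 _) (normr_ge0 _)).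
lra.
Qed.

(** If the initial state is smaller in norm than the input, [sigma] of the input norm bounds the
    whole trajectory. Otherwise the excess over [gamma] of the input norm is at most [sigma] of the
    state norm and decays uniformly on bounded sets, hence has a KL majorant. *)
Lemma small_gain_ISS : ISS Sigma.
Proof.
have bK : class_K (beta_max^~ 0) by have [_ + _] := beta_maxKL; apply.
pose sigma r := xi (beta_max r 0 + gamma_max r).
have sigmaK : class_K sigma := class_K_comp xiK (class_KD bK gamma_maxK).
pose zeta r := xi (gamma_max (r + r) + gamma_max (r + r)).
have zetaK : class_K zeta.
  have g2K := class_K_comp gamma_maxK (class_KD class_K_id class_K_id).
  exact: (class_K_comp xiK (class_KD g2K g2K)).
(* [zeta] is the asymptotic gain; [sigma] is added for initial states smaller than the input. *)
pose gamma r := sigma r + zeta r.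
have gammaK : class_K gamma by exact: class_KD.
have gamma0 (u : U) : 0 <= gamma `|u| by exact: class_K_ge0.
have phi_le (x : bfam X) (u : U) t s : `|x| <= s -> `|u| <= s ->
    `|phi t x u| <= sigma s.
  move=> xs us; apply: le_trans (state_bound (fcSigma t x u)) _.
  rewrite class_K_le ?addr_ge0 ?(class_K_ge0 bK) ?class_K_ge0//.
  by apply: lerD; [exact: (class_K_le bK)|exact: class_K_le].
(* On [A] a bound on the initial state also bounds the input, as both the [sigma] bound and the
   uniform decay require. *)
pose A := {a : bfam X * U * {nonneg R} | `|a.1.2| <= `|a.1.1| }.
pose v (a : A) := let: (x, u, t) := sval a in
  Num.max 0 (`|phi t x u| - gamma `|u|).
have [||a|r e r0 e0|b bKL vb] := @class_KL_majorant R A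
    (fun a => `|(sval a).1.1|) (fun a => (sval a).2%:num) v sigma sigmaK.
- by [].
- by move=> [[[x u] t] ux]; rewrite /v /= le_max lexx.
- case: a => -[[x u] t] /= ux; rewrite /v /= ge_max class_K_ge0//= lerBlDr.
  by rewrite ler_wpDr// phi_le.
- have [T TP] := uniform_ultimate_bound r0 e0; exists T.
  move=> [[[x u] t] /= ux] xr Tt; rewrite /v /= ge_max ltW//= lerBlDr.
  apply: le_trans (TP _ _ _ xr (le_trans ux xr) Tt) _.
  by rewrite lerD2l lerDr class_K_ge0.
exists b, gamma; split=> //; first by left.
move=> t x u _; have [ux|/ltW xu] := leP `|u| `|x|.
  have := vb (exist _ (x, u, t) ux); rewrite /v /= ge_max => /andP[_].
  by rewrite lerBlDr.
have b0 : 0 <= b `|x| t%:num.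
  by have [_ bK' _] := bKL; apply: (class_K_ge0 (bK' _ _)).
apply: le_trans (phi_le _ _ _ _ xu (lexx _)) _.
by rewrite /gamma addrCA lerDl addr_ge0// class_K_ge0.
Qed.

End SmallGain.

Theorem theorem6p2 (R : realType) (I : Type) (I_nonempty : inhabited I)
    (X : I -> normedModType R) (U : inputSpace R)
    (S : forall i : I, transition (X i) (subinputs X U i))
    (Sigma : transition (bfam X) U)
    (beta : I -> R -> R -> R) (gam : I -> I -> R -> R) (gamu : I -> R -> R)
    (beta_max : R -> R -> R) (gamma_max : R -> R) :
  (forall i, control_system (S i)) ->
  (forall i, forward_complete (S i)) ->
  well_defined_interconnection S Sigma ->
  (forall i, ISS_semimax S i (beta i) (gam i) (gamu i)) ->
  class_KL beta_max ->
  class_K gamma_max ->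
  (forall i r t, 0 <= r -> 0 <= t -> beta i r t <= beta_max r t) ->
  (forall i r, 0 <= r -> gamu i r <= gamma_max r) ->
  (forall r, 0 < r -> has_ubound [set gam ij.1 ij.2 r | ij in [set: I * I]]) ->
  MLIM (linf_pos I) (gain_op gam) ->
  ISS Sigma.
Proof.
move=> _ _ [[inter _] _ cs bic] semimax bKL gK ble gle gb [xi [xiK _] mlim].
have fc : forward_complete Sigma.
  exact: (BIC_forward_complete inter cs semimax bKL gK ble gle gb xiK mlim bic).
exact: (small_gain_ISS inter cs semimax bKL gK ble gle gb xiK mlim fc).
Qed.
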